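(* Let $n\ge 2$, and let $\Sigma=(S_1,\dots,S_{n-1},P)$ and $\Sigma'=(S_1',\dots,S_{n-1}',P')$ be two $\Gamma_n$-contractions on Hilbert spaces $\mathcal H$ and $\mathcal H'$ respectively. Then $(S_1,\dots,S_{n-1},P)$ is unitarily equivalent to $(S_1',\dots,S_{n-1}',P')$ if and only if $\Theta_\Sigma$ and $\Theta_{\Sigma'}$ coincide.
   Context: $\mathbb D$ is the open unit disc in $\mathbb C$. The closed symmetrized polydisc is $\Gamma_n=\pi_n(\overline{\mathbb D}^n)$, where $\pi_n(z_1,\dots,z_n)=\big(\sum_{i}z_i,\sum_{i<j}z_iz_j,\dots,\prod_i z_i\big)$. A compact set $X\subset\mathbb C^n$ is a spectral set for a commuting tuple $\underline T$ of bounded operators if the Taylor joint spectrum $\sigma(\underline T)\subseteq X$ and $\|f(\underline T)\|\le\sup_{x\in X}|f(x)|$ for every rational function $f$ with poles off $X$. A $\Gamma_n$-contraction is a commuting $n$-tuple $(S_1,\dots,S_{n-1},P)$ of bounded operators on a Hilbert space for which $\Gamma_n$ is a spectral set. Given a $\Gamma_n$-contraction $\Sigma=(S_1,\dots,S_{n-1},P)$ on $\mathcal H$, put $S_n=P$ and, for $a\in\mathbb C$, $T_a=I+\sum_{i=1}^{n-1}(-\bar a)^iS_i+(-\bar a)^nP$. Let $\Lambda_\Sigma=\{a\in\mathbb C: T_a\text{ is invertible}\}$; it is known that $\mathbb D\subseteq\Lambda_\Sigma$. For $a\in\Lambda_\Sigma$ define $\Theta_\Sigma(a)=(S_{1\tau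 a},\dots,S_{(n-1)\tau a},S_{n\tau a})$, where for $i=1,\dots,n$ $$S_{i\tau a}=\Big(\sum_{j=1}^{i-1}(-a)^{i-j}\Big[\sum_{k=0}^{j}\binom{n-j}{i-j+k}\binom{j}{k}|a|^{2k}\Big]S_j\Big)T_a^{-1}+\Big(\sum_{j=i}^{n}(-\bar a)^{j-i}\Big[\sum_{k=0}^{i}\binom{j}{i-k}\binom{n-j}{k}|a|^{2k}\Big]S_j\Big)T_a^{-1}+(-a)^i\binom{n}{i}T_a^{-1},$$ with $\binom{p}{q}=0$ if $q>p$ or $q<0$. The objects $S_{i\tau a}'$, $\Lambda_{\Sigma'}$ and $\Theta_{\Sigma'}$ are defined in the same way from $\Sigma'$. $\Theta_\Sigma$ and $\Theta_{\Sigma'}$ are said to coincide if $S_{i\tau a}$ is unitarily equivalent to $S_{i\tau a}'$ by the same unitary for all $i=1,\dots,n$ and all $a\in\Lambda_\Sigma\cap\Lambda_{\Sigma'}$, i.e. there is a unitary $U:\mathcal H\to\mathcal H'$ with $US_{i\tau a}=S_{i\tau a}'U$ for all such $i$ and $a$. Two tuples are unitarily equivalent if there is a unitary $U:\mathcal H\to\mathcal H'$ with $US_i=S_i'U$ for $i=1,\dots,n-1$ and $UP=P'U$. *)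

(* Defs.v *)
From HB Require Import structures.
From mathcomp Require Import all_boot all_order all_algebra.
From mathcomp Require Import complex.
From mathcomp Require Import all_classical all_reals ereal topology normedtype.
From mathcomp Require mpoly.

Set Implicit Arguments.
Unset Strict Implicit.
Unset Printing Implicit Defensive.

Import Order.TTheory GRing.Theory Num.Theory.
Import numFieldNormedType.Exports.

Local Open Scope classical_set_scope.
Local Open Scope ring_scope.

(* Complex Hilbert spaces: the inner product is linear in its first argument
   and conjugate-linear in the second. *)
HB.mixin Record CompleteNormedModule_isHilbert (R : realType) (H : Type)
    of CompleteNormedModule R[i] H := {
  hdot : {dot H for (@Num.conj R[i])} ;
  hdot_norm : forall x : H, `|x| ^+ 2 = hdot x x
}.

#[short(type="hilbertType")]
HB.structure Definition Hilbert (R : realType) :=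
  {H of CompleteNormedModule R[i] H & CompleteNormedModule_isHilbert R H}.

(* Operators are plain functions, so that sums, scalings and compositions are
   those of the function space H -> H. *)
Definition bounded_op (R : realType) (H : hilbertType R) (A : H -> H) : Prop :=
  linear A /\ exists M : R, forall x : H, `|A x| <= (M%:C)%C * `|x|.

Definition op_norm (R : realType) (H : hilbertType R) (A : H -> H) : \bar R :=
  ereal_sup [set (complex.Re `|A x|)%:E | x in [set x : H | `|x| <= 1]].

Definition op_inverse (R : realType) (H : hilbertType R) (A B : H -> H) :
    Prop :=
  [/\ bounded_op B, cancel A B & cancel B A].

Definition op_invertible (R : realType) (H : hilbertType R) (A : H -> H) :
    Prop :=
  exists B, op_inverse A B.

(* The inverse of an invertible operator; the junk value 0 otherwise. *)
Definition op_inv (R : realType) (H : hilbertType R) (A : H -> H) : H -> H :=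
  xget (fun _ => 0) [set B | op_inverse A B].

Definition unitary (R : realType) (H H' : hilbertType R) (U : H -> H') : Prop :=
  [/\ linear U,
      forall x y : H, hdot (U x) (U y) = hdot x y
    & forall y : H', exists x : H, U x = y].

(* An n-tuple of operators (S_1, ..., S_n) is indexed from 0: S i is the
   operator numbered i.+1. *)
Definition commuting_tuple (R : realType) (H : hilbertType R) (n : nat)
    (S : 'I_n -> H -> H) : Prop :=
  forall i j : 'I_n, S i \o S j = S j \o S i.

(* Koszul differential on H (x) Lambda(C^n):
     x (x) e_K |-> \sum_i A_i x (x) (e_i /\ e_K).
   An element is a family f indexed by J : {set 'I_n}, f J being the coefficient
   of e_J = e_j1 /\ ... /\ e_jp, where j1 < ... < jp enumerate J. *)
Definition koszul (R : realType) (H : hilbertType R) (n : nat)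
    (A : 'I_n -> H -> H) (f : {set 'I_n} -> H) : {set 'I_n} -> H :=
  fun J => \sum_(i in J)
    ((-1) ^+ #|[set k in J | (k < i)%N]|) *: A i (f (J :\ i)%SET).

Definition koszul_exact (R : realType) (H : hilbertType R) (n : nat)
    (A : 'I_n -> H -> H) : Prop :=
  forall f, koszul A f = (fun=> 0) -> exists g, f = koszul A g.

Definition taylor_spectrum (R : realType) (H : hilbertType R) (n : nat)
    (S : 'I_n -> H -> H) : set ('I_n -> R[i]) :=
  [set l | ~ koszul_exact (fun i x => S i x - l i *: x)].

Definition mon_op (R : realType) (H : hilbertType R) (n : nat)
    (S : 'I_n -> H -> H) (m : mpoly.multinom n) : H -> H :=
  \big[(fun A B : H -> H => A \o B)/(idfun : H -> H)]_(i < n)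
    iter (mpoly.fun_of_multinom m i) (S i).

Definition poly_op (R : realType) (H : hilbertType R) (n : nat)
    (S : 'I_n -> H -> H) (p : mpoly.mpoly n R[i]) : H -> H :=
  \sum_(m <- mpoly.msupp p) mpoly.mcoeff m p *: mon_op S m.

Definition rat_op (R : realType) (H : hilbertType R) (n : nat)
    (S : 'I_n -> H -> H) (p q : mpoly.mpoly n R[i]) : H -> H :=
  poly_op S p \o op_inv (poly_op S q).

(* For X compact.  The rational functions with poles off X are the p / q with q
   free of zeros on X; then q(S) is invertible as soon as X contains the Taylor
   spectrum of S, by the spectral mapping theorem. *)
Definition spectral_set (R : realType) (H : hilbertType R) (n : nat)
    (X : set ('I_n -> R[i])) (S : 'I_n -> H -> H) : Prop :=
  taylor_spectrum S `<=` X /\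
  forall p q : mpoly.mpoly n R[i],
    (forall z, X z -> mpoly.meval z q != 0) ->
    (op_norm (rat_op S p q) <=
     ereal_sup
       [set (complex.Re `|mpoly.meval z p / mpoly.meval z q|)%:E | z in X])%E.

Definition sympoly_map (R : realType) (n : nat) (z : 'I_n -> R[i]) :
    'I_n -> R[i] :=
  fun i => mpoly.meval z (mpoly.mesym n R[i] i.+1).

Definition Gamma (R : realType) (n : nat) : set ('I_n -> R[i]) :=
  @sympoly_map R n @` [set z | forall i, `|z i| <= 1].

(* The last component of the tuple is P. *)
Definition Gamma_contraction (R : realType) (H : hilbertType R) (n : nat)
    (S : 'I_n -> H -> H) : Prop :=
  [/\ forall i, bounded_op (S i), commuting_tuple S
    & spectral_set (@Gamma R n) S].

Definition Tmap (R : realType) (H : hilbertType R) (n : nat)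
    (S : 'I_n -> H -> H) (a : R[i]) : H -> H :=
  (idfun : H -> H) + \sum_(i < n) (- Num.conj a) ^+ i.+1 *: S i.

Definition Lambda (R : realType) (H : hilbertType R) (n : nat)
    (S : 'I_n -> H -> H) : set R[i] :=
  [set a | op_invertible (Tmap S a)].

(* Coefficients of S_j in the formula for S_{i tau a}, for j < i and for j >= i;
   here i and j are numbered from 1. *)
Definition tau_coef_lt (R : realType) (n : nat) (a : R[i]) (i j : nat) : R[i] :=
  (- a) ^+ (i - j) *
  \sum_(0 <= k < j.+1)
    ('C(n - j, i - j + k) * 'C(j, k))%:R * `|a| ^+ (2 * k).

Definition tau_coef_ge (R : realType) (n : nat) (a : R[i]) (i j : nat) : R[i] :=
  (- Num.conj a) ^+ (j - i) *
  \sum_(0 <= k < i.+1)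
    ('C(j, i - k) * 'C(n - j, k))%:R * `|a| ^+ (2 * k).

Definition Theta (R : realType) (H : hilbertType R) (n : nat)
    (S : 'I_n -> H -> H) (a : R[i]) (i : 'I_n) : H -> H :=
  ((\sum_(j < n | (j < i)%N) tau_coef_lt n a i.+1 j.+1 *: S j)
     \o op_inv (Tmap S a))
  + ((\sum_(j < n | (i <= j)%N) tau_coef_ge n a i.+1 j.+1 *: S j)
       \o op_inv (Tmap S a))
  + ((- a) ^+ i.+1 * 'C(n, i.+1)%:R) *: op_inv (Tmap S a).

Definition Theta_coincide (R : realType) (H H' : hilbertType R) (n : nat)
    (S : 'I_n -> H -> H) (S' : 'I_n -> H' -> H') : Prop :=
  exists U : H -> H', unitary U /\
    forall (i : 'I_n) (a : R[i]), (Lambda S `&` Lambda S') a ->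
      U \o Theta S a i = Theta S' a i \o U.

Definition unitarily_equivalent (R : realType) (H H' : hilbertType R) (n : nat)
    (S : 'I_n -> H -> H) (S' : 'I_n -> H' -> H') : Prop :=
  exists U : H -> H', unitary U /\ forall i : 'I_n, U \o S i = S' i \o U.

(* Main.v *)
Require Import Defs.
From mathcomp Require Import all_boot all_order all_algebra.
From mathcomp Require Import all_classical all_reals.
From mathcomp Require Import complex normedtype.

(** The map Theta_Sigma is built from Sigma by sums, scalings, compositions and
    the inverse of T_a, all of which are preserved by conjugation with a
    unitary: if U carries S_i to S_i', it carries T_a to T_a' and hence
    S_(i tau a) to S_(i tau a)'.  This is the closure of the relation
    [intertwines] under these operations.

    Conversely, Sigma can be read off from Theta_Sigma at the origin.  There
    T_0 = I is invertible, and every term of S_(i tau 0) carries a positive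
    power of a or of its conjugate, except the one with j = i and k = 0, whose
    binomial factor is 1; so Theta_Sigma(0) = Sigma ([Theta0]).  A unitary
    carrying Theta_Sigma to Theta_Sigma' therefore carries Sigma to Sigma'. *)

Import GRing.Theory Num.Theory.
Local Open Scope ring_scope.

Definition intertwines (R : realType) (H H' : hilbertType R) (U : H -> H')
    (A : H -> H) (A' : H' -> H') : Prop :=
  U \o A = A' \o U.
Arguments intertwines {R H H'} U A A'.

Section Intertwining.
Variables (R : realType) (H H' : hilbertType R) (U : H -> H').

Lemma intertwines_id : intertwines U idfun idfun.
Proof. by []. Qed.

Lemma intertwines_comp A A' B B' :
  intertwines U A A' -> intertwines U B B' ->
  intertwines U (A \o B) (A' \o B').
Proof.
move=> UA UB; apply/funext => x /=.
by have /= -> := congr1 (@^~ (B x)) UA; have /= -> := congr1 (@^~ x) UB.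
Qed.

(** Multiplying [U \o A = A' \o U] by the inverse of A' on the left and by that
    of A on the right gives the same relation between the inverses. *)
Lemma intertwines_op_inv A A' :
  op_invertible A -> op_invertible A' ->
  intertwines U A A' -> intertwines U (op_inv A) (op_inv A').
Proof.
move=> [B AB] [B' AB'] UA.
have [_ _ AVK] : op_inverse A (op_inv A) by apply: xgetPex; exists B.
have [_ A'K _] : op_inverse A' (op_inv A') by apply: xgetPex; exists B'.
apply/funext => x /=; rewrite -[LHS]A'K.
by have /= <- := congr1 (@^~ (op_inv A x)) UA; rewrite AVK.
Qed.

Hypothesis U_linear : linear U.

Let U_scale_add c x y : U (c *: x + y) = c *: U x + U y.
Proof. exact: U_linear. Qed.

Let U_add x y : U (x + y) = U x + U y.
Proof. by rewrite -[x]scale1r U_scale_add !scale1r. Qed.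

Let U0 : U 0 = 0.
Proof. by apply: (addrI (U 0)); rewrite -U_add !addr0. Qed.

Lemma intertwinesD A A' B B' :
  intertwines U A A' -> intertwines U B B' -> intertwines U (A + B) (A' + B').
Proof.
move=> UA UB; apply/funext => x /=; rewrite !fctE U_add.
by have /= -> := congr1 (@^~ x) UA; have /= -> := congr1 (@^~ x) UB.
Qed.

Lemma intertwinesZ c A A' :
  intertwines U A A' -> intertwines U (c *: A) (c *: A').
Proof.
move=> UA; apply/funext => x /=; rewrite !fctE -[c *: A x]addr0.
by rewrite U_scale_add U0 addr0; have /= -> := congr1 (@^~ x) UA.
Qed.

Lemma intertwines_sum (I : Type) (r : seq I) (P : pred I) A A' :
  (forall i, intertwines U (A i) (A' i)) ->
  intertwines U (\sum_(i <- r | P i) A i) (\sum_(i <- r | P i) A' i).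
Proof.
move=> UA; apply: (big_ind2 (intertwines U)) => //.
- by apply/funext => x; exact: U0.
- by move=> ? ? ? ?; exact: intertwinesD.
Qed.

Variables (n : nat) (S : 'I_n -> H -> H) (S' : 'I_n -> H' -> H').
Hypothesis US : forall i, intertwines U (S i) (S' i).

Lemma intertwines_Tmap a : intertwines U (Tmap S a) (Tmap S' a).
Proof.
apply: intertwinesD; first exact: intertwines_id.
by apply: intertwines_sum => i; exact: intertwinesZ.
Qed.

Lemma intertwines_Theta a i :
  Lambda S a -> Lambda S' a -> intertwines U (Theta S a i) (Theta S' a i).
Proof.
move=> Sa S'a.
have UTV : intertwines U (op_inv (Tmap S a)) (op_inv (Tmap S' a)).
  by apply: intertwines_op_inv => //; exact: intertwines_Tmap.
apply: intertwinesD; last exact: intertwinesZ.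
by apply: intertwinesD; apply: intertwines_comp => //;
  apply: intertwines_sum => j; exact: intertwinesZ.
Qed.

End Intertwining.

Section Origin.
Variables (R : realType) (H : hilbertType R) (n : nat) (S : 'I_n -> H -> H).

Lemma op_inverse_id : op_inverse (idfun : H -> H) idfun.
Proof.
split=> //; split; first by [].
by exists 1 => x; rewrite mul1r.
Qed.

Lemma op_inv_id : op_inv (idfun : H -> H) = idfun.
Proof.
have [_ idK _] : op_inverse (idfun : H -> H) (op_inv idfun).
  by apply: xgetPex; exists idfun; exact: op_inverse_id.
by apply/funext => x; exact: idK.
Qed.

Lemma Tmap0 : Tmap S 0 = idfun.
Proof.
rewrite /Tmap big1 ?addr0// => i _.
by rewrite rmorph0 oppr0 expr0n scale0r.
Qed.

Lemma Lambda0 : Lambda S 0.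
Proof. by rewrite /Lambda /= Tmap0; exists idfun; exact: op_inverse_id. Qed.

Lemma tau_coef_lt0 i j : (j < i)%N -> tau_coef_lt n (0 : R[i]) i j = 0.
Proof.
by move=> ji; rewrite /tau_coef_lt oppr0 expr0n subn_eq0 leqNgt ji mul0r.
Qed.

(** For i < j the power of a outside the sum vanishes; for i = j it is 1, and of
    the inner sum only k = 0 survives, the other terms containing |a|. *)
Lemma tau_coef_ge0 i j :
  (i <= j)%N -> tau_coef_ge n (0 : R[i]) i j = (i == j)%:R.
Proof.
move=> ij; rewrite /tau_coef_ge rmorph0 oppr0 expr0n subn_eq0.
case: eqVneq => [<-|ij']; last first.
  by rewrite leqNgt ltn_neqAle ij' ij mul0r.
rewrite leqnn mul1r big_nat_recl// big1 => [|k _].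
  by rewrite subn0 binn bin0 muln0 expr0 mulr1 addr0.
by rewrite normr0 expr0n mulnS mulr0.
Qed.

Lemma Theta0 i : Theta S 0 i = S i.
Proof.
rewrite /Theta Tmap0 op_inv_id oppr0 expr0n mul0r scale0r addr0.
rewrite [X in (X \o _) + _]big1 => [|j ji]; last first.
  by rewrite tau_coef_lt0 ?scale0r.
have -> : \sum_(j < n | (i <= j)%N) tau_coef_ge n 0 i.+1 j.+1 *: S j = S i.
  rewrite (bigD1 i)//= tau_coef_ge0// eqxx scale1r big1 ?addr0// => j.
  case/andP=> ij ji; rewrite tau_coef_ge0// eqSS eq_sym.
  by rewrite (negbTE (ji : (j : nat) != i)) scale0r.
by apply/funext => x; exact: add0r.
Qed.

End Origin.

Theorem theorem3p3 (R : realType) (n : nat) (n_ge2 : (2 <= n)%N)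
    (H H' : hilbertType R)
    (S : 'I_n -> H -> H) (S' : 'I_n -> H' -> H')
    (S_contr : Gamma_contraction S) (S'_contr : Gamma_contraction S') :
  unitarily_equivalent S S' <-> Theta_coincide S S'.
Proof.
split=> -[U [U_unitary UE]]; exists U; split=> //.
- have [U_linear _ _] := U_unitary.
  by move=> i a [Sa S'a]; exact: intertwines_Theta.
- move=> i; rewrite -(Theta0 _ _ _ S) -(Theta0 _ _ _ S').
  by apply: UE; split; exact: Lambda0.
Qed.
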